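(* Let $N\ge 1$ and let $(U_x)_{x\in C_N}$ be a 3-colour percolation model with Dobrushin boundary condition on the cube $C_N=\{0,1,\ldots,N\}^3$. Let $c_f$ and $c_{f'}$ be the centres (barycentres) of the boundary triangles $f$ with vertices $(0,0,0),(1,0,0),(1,0,1)$ and $f'$ with vertices $(N,N,N),(N,N-1,N),(N,N-1,N-1)$. Then, almost surely, there is a unique 3-colour line joining $c_f$ to $c_{f'}$, that is, there exist a unique integer $L_N\ge 1$ and a unique 3-colour line $\Gamma:[0,L_N]\to[0,N]^3$ made of $L_N$ segments with $\Gamma(0)=c_f$ and $\Gamma(L_N)=c_{f'}$; moreover $\Gamma$ is non-self-intersecting (injective). Thus the model defines a random non-self-intersecting piecewise affine curve $\Gamma:[0,L_N]\to [0,N]^3$.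
   Context: Geometry. For integers $0\le k_1,k_2,k_3<N$ and a permutation $\rho$ of $\{1,2,3\}$, let $$t_\rho(k_1,k_2,k_3)=\{(k_1+x_1,k_2+x_2,k_3+x_3):\ (x_1,x_2,x_3)\in[0,1]^3,\ 0\le x_{\rho(1)}\le x_{\rho(2)}\le x_{\rho(3)}\le 1\}.$$ These $6N^3$ tetrahedra tile the real cube $[0,N]^3$, and their vertices are the points of $C_N=\{0,\ldots,N\}^3$. The faces (resp. edges, vertices) of a tetrahedron are the subsets obtained by replacing one (resp. two, three) of the four inequalities by equalities. Dobrushin boundary condition. Let $F^{(i)}_k$ be the strict face of $C_N$ on which the $i$-th coordinate equals $k\in\{0,N\}$ (the other two coordinates lie in $\{1,\dots,N-1\}$), and $E^{(i,j)}_{k,l}$ the strict edge of $C_N$ on which the $i$-th coordinate equals $k$ and the $j$-th coordinate equals $l$, with $k,l\in\{0,N\}$ (the remaining coordinate lies in $\{1,\dots,N-1\}$). A 3-colour percolation model with Dobrushin boundary condition on $C_N$ is a family of independent random variables $(U_x)_{x\in C_N}$ with values in $\{0,1,2\}$ (colours) such that: - for $x\in\{1,\ldots,N-1\}^3$, $U_x$ is uniform on $\{0,1,2\}$; - $U_x=0$ a.s. for $x\in\{(0,0,0),(0,N,0),(0,0,N),(N,N,0),(0,N,N),(N,N,N)\}\cup F^{(1)}_0\cup F^{(2)}_N\cup E^{(2,3)}_{N,0}\cup E^{(2,3)}_{N,N}\cup E^{(1,3)}_{0,N}\cup E^{(1,2)}_{0,0}\cup E^{(1,2)}_{0,N}\cup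 E^{(1,2)}_{N,N}$; - $U_x=1$ a.s. for $x\in\{(N,0,N)\}\cup F^{(2)}_0\cup F^{(3)}_N\cup E^{(2,3)}_{0,N}\cup E^{(1,3)}_{N,N}$; - $U_x=2$ a.s. for $x\in\{(N,0,0)\}\cup F^{(1)}_N\cup F^{(3)}_0\cup E^{(2,3)}_{0,0}\cup E^{(1,3)}_{0,0}\cup E^{(1,3)}_{N,0}\cup E^{(1,2)}_{N,0}$. 3-colour lines. A triangular face of a tetrahedron is tricolour if its three vertices carry the three different colours. If the vertices of a tetrahedron carry all three colours, then one colour appears twice and the other two once, and the tetrahedron has exactly two tricolour faces; the segment joining the centres of these two faces is the 3-colour segment of that tetrahedron. A 3-colour line made of $L\ge1$ segments is a continuous map $\Gamma:[0,L]\to[0,N]^3$ such that, for each $j=1,\ldots,L$, $\Gamma$ is affine on $[j-1,j]$ and maps $[j-1,j]$ bijectively onto the 3-colour segment of some tetrahedron, and the 3-colour segments for $j$ and $j+1$ are distinct (belong to distinct tetrahedra) for each $1\le j<L$. It joins $\Gamma(0)$ to $\Gamma(L)$. *)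

(* Defs.v *)
From HB Require Import structures.
From mathcomp Require Import all_boot all_order all_algebra all_fingroup.
From mathcomp Require Import all_classical all_reals all_analysis.

Set Implicit Arguments.
Unset Strict Implicit.
Unset Printing Implicit Defensive.

Import Order.TTheory GRing.Theory Num.Theory.
Import numFieldNormedType.Exports.

Local Open Scope classical_set_scope.
Local Open Scope ring_scope.

(* The coordinates 1, 2, 3 are numbered from 0. *)
Definition ax1 : 'I_3 := @Ordinal 3 0 isT.
Definition ax2 : 'I_3 := @Ordinal 3 1 isT.
Definition ax3 : 'I_3 := @Ordinal 3 2 isT.

Definition colour := 'I_3.
Definition colour0 : colour := @Ordinal 3 0 isT.
Definition colour1 : colour := @Ordinal 3 1 isT.
Definition colour2 : colour := @Ordinal 3 2 isT.

(* The discrete cube C_N = {0, ..., N}^3. *)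
Definition dcube (N : nat) := {ffun 'I_3 -> 'I_N.+1}.

(* A pair (k, rho) stands for the tetrahedron t_rho(k). *)
Definition tetra (N : nat) := ({ffun 'I_3 -> 'I_N} * {perm 'I_3})%type.

Section Geometry.
Variable R : realType.

Definition latt (n : nat) (v : {ffun 'I_3 -> 'I_n}) : 'rV[R]_3 :=
  \row_i (v i)%:R.

Definition rpoint (a b c : nat) : 'rV[R]_3 := \row_i (nth 0%N [:: a; b; c] i)%:R.

Definition barycentre3 (p q r : 'rV[R]_3) : 'rV[R]_3 := 3^-1 *: (p + q + r).

Definition rcube (N : nat) : set 'rV[R]_3 :=
  [set p | forall i, 0 <= p 0 i <= N%:R].

Definition rsegment (p q : 'rV[R]_3) : set 'rV[R]_3 :=
  [set (1 - s) *: p + s *: q | s in `[0, 1]].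

(* The j-th inequality defining t_rho(k), j = 0, ..., 3, says that the j-th  *)
(* entry of the following list is at most the (j+1)-th one.                  *)
Definition chain (rho : {perm 'I_3}) (x : 'rV[R]_3) : seq R :=
  [:: 0; x 0 (rho ax1); x 0 (rho ax2); x 0 (rho ax3); 1].

(* The part of the tetrahedron obtained by replacing the inequalities in E   *)
(* by equalities: the tetrahedron itself, a face, an edge or a vertex for    *)
(* #|E| = 0, 1, 2 or 3.                                                      *)
Definition tetra_part (N : nat) (t : tetra N) (E : {set 'I_4}) :
    set 'rV[R]_3 :=
  [set latt t.1 + x | x in [set x : 'rV[R]_3 | forall j : 'I_4,
    (chain t.2 x)`_j <= (chain t.2 x)`_j.+1 /\
    (j \in E -> (chain t.2 x)`_j = (chain t.2 x)`_j.+1)]].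

Definition is_vertex (N : nat) (t : tetra N) (v : dcube N) : Prop :=
  exists2 E : {set 'I_4}, #|E| = 3%N & tetra_part t E = [set latt v].

(* The three vertices of the face of t on which inequality j is tight. *)
Definition face_vertices (N : nat) (t : tetra N) (j : 'I_4) :
    {set dcube N} :=
  [set v | `[< is_vertex t v /\ tetra_part t [set j]%SET (latt v) >]]%SET.

Definition face_centre (N : nat) (t : tetra N) (j : 'I_4) : 'rV[R]_3 :=
  3^-1 *: \sum_(v in face_vertices t j) latt v.

Definition tricolour (N : nat) (u : dcube N -> colour) (t : tetra N)
    (j : 'I_4) : Prop :=
  forall c : colour, exists2 v, v \in face_vertices t j & u v = c.

Definition is_colour_segment (N : nat) (u : dcube N -> colour) (t : tetra N)
    (S : set 'rV[R]_3) : Prop :=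
  exists j j' : 'I_4, [/\ j != j', tricolour u t j, tricolour u t j' &
    S = rsegment (face_centre t j) (face_centre t j')].

Definition affine_on (A : set R) (G : R -> 'rV[R]_3) : Prop :=
  exists p q : 'rV[R]_3, forall s, A s -> G s = p + s *: q.

(* A line is a map on [0, L]; it is represented by a map G on the whole real *)
(* line, of which only the restriction to [0, L] matters.                    *)
Definition colour_line (N : nat) (u : dcube N -> colour) (L : nat)
    (G : R -> 'rV[R]_3) : Prop :=
  [/\ (1 <= L)%N,
      {within `[0, L%:R], continuous G},
      forall s, 0 <= s <= L%:R -> rcube N (G s) &
      exists t : nat -> tetra N,
        (forall j, (j < L)%N ->
           affine_on `[j%:R, j.+1%:R] G /\
           exists2 S, is_colour_segment u (t j) S &
                      set_bij `[j%:R, j.+1%:R] S G) /\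
        (forall j, (j.+1 < L)%N -> t j != t j.+1)].

Definition colour_line_joining (N : nat) (u : dcube N -> colour)
    (p q : 'rV[R]_3) (L : nat) (G : R -> 'rV[R]_3) : Prop :=
  [/\ colour_line u L G, G 0 = p & G L%:R = q].

Definition non_self_intersecting (L : nat) (G : R -> 'rV[R]_3) : Prop :=
  set_inj `[0, L%:R] G.

End Geometry.

Section Boundary.
Local Open Scope nat_scope.
Variable N : nat.

Definition corner (a b c : nat) : {set dcube N} :=
  [set x : dcube N | [&& x ax1 == a :> nat, x ax2 == b :> nat
                       & x ax3 == c :> nat]]%SET.

Definition strict_face (i : 'I_3) (k : nat) : {set dcube N} :=
  [set x : dcube N | (x i == k :> nat)
     && [forall h : 'I_3, (h != i) ==> (0 < x h < N)]]%SET.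

Definition strict_edge (i j : 'I_3) (k l : nat) : {set dcube N} :=
  [set x : dcube N | [&& x i == k :> nat, x j == l :> nat
     & [forall h : 'I_3, (h != i) && (h != j) ==> (0 < x h < N)]]]%SET.

Definition strict_interior : {set dcube N} :=
  [set x : dcube N | [forall h : 'I_3, 0 < x h < N]]%SET.

Definition boundary0 : {set dcube N} :=
  (corner 0 0 0 :|: corner 0 N 0 :|: corner 0 0 N :|: corner N N 0
   :|: corner 0 N N :|: corner N N N
   :|: strict_face ax1 0 :|: strict_face ax2 N
   :|: strict_edge ax2 ax3 N 0 :|: strict_edge ax2 ax3 N N
   :|: strict_edge ax1 ax3 0 N
   :|: strict_edge ax1 ax2 0 0 :|: strict_edge ax1 ax2 0 N
   :|: strict_edge ax1 ax2 N N)%SET.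

Definition boundary1 : {set dcube N} :=
  (corner N 0 N
   :|: strict_face ax2 0 :|: strict_face ax3 N
   :|: strict_edge ax2 ax3 0 N
   :|: strict_edge ax1 ax3 N N)%SET.

Definition boundary2 : {set dcube N} :=
  (corner N 0 0
   :|: strict_face ax1 N :|: strict_face ax3 0
   :|: strict_edge ax2 ax3 0 0
   :|: strict_edge ax1 ax3 0 0 :|: strict_edge ax1 ax3 N 0
   :|: strict_edge ax1 ax2 N 0)%SET.

End Boundary.

Section Model.
Context {R : realType} {d : measure_display} {T : measurableType d}.
Variable P : probability T R.

(* Colours form a finite discrete space, so that every set of colours is an  *)
(* event and measurability can be tested on singletons.                      *)
Definition colour_variable (V : T -> colour) : Prop :=
  forall c, measurable (V @^-1` [set c]).

Definition mutually_independent (I : finType) (V : I -> T -> colour) : Prop :=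
  forall (J : {set I}) (B : I -> set colour),
    P (\bigcap_(x in [set x | x \in J]) (V x @^-1` B x)) =
    (\prod_(x in J) P (V x @^-1` B x))%E.

Record dobrushin_model (N : nat) (U : dcube N -> T -> colour) : Prop := {
  dobrushin_measurable : forall x, colour_variable (U x);
  dobrushin_independent : mutually_independent U;
  dobrushin_uniform : forall x, x \in strict_interior N ->
    forall c, P (U x @^-1` [set c]) = (3^-1)%:E;
  dobrushin_colour0 : forall x, x \in boundary0 N ->
    \forall w \ae P, U x w = colour0;
  dobrushin_colour1 : forall x, x \in boundary1 N ->
    \forall w \ae P, U x w = colour1;
  dobrushin_colour2 : forall x, x \in boundary2 N ->
    \forall w \ae P, U x w = colour2 }.

(* A random curve of random integer length: the Borel sigma-algebra of the   *)
(* space of continuous curves is generated by the length and the             *)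
(* evaluations.                                                              *)
Definition random_curve (L : T -> nat) (G : T -> R -> 'rV[R]_3) : Prop :=
  measurable_fun setT L /\
  forall (s : R) (i : 'I_3), measurable_fun setT (fun w => G w s 0 i).

End Model.

(* Main.v *)
Require Import Defs.
From mathcomp Require Import all_boot all_order all_algebra all_fingroup.
From mathcomp Require Import all_classical all_reals all_analysis.
From mathcomp Require Import zify ring lra.

(* Call a pair (tetrahedron, one of its faces) a dart. On the finite set of  *)
(* tricolour darts there are two involutions: [a] exchanges the two          *)
(* tricolour faces of a tetrahedron and has no fixed point, [b] passes to    *)
(* the other tetrahedron with the same face and fixes exactly the darts      *)
(* whose face lies on the boundary of the cube. The boundary colours leave   *)
(* only two tricolour boundary faces, [f] and [f']. Iterating [b \o a] from  *)
(* [f] follows the 3-colour line; the orbit has even length and its midpoint *)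
(* is a fixed point of [b] other than the dart of [f], so the line reaches   *)
(* [f']. Faces are recognised by their centres and tetrahedra have disjoint  *)
(* interiors, hence a line starting at the centre of [f] has no choice and   *)
(* does not meet itself. There are finitely many colour configurations, so   *)
(* the line is a measurable function of the configuration.                   *)

Set Implicit Arguments.
Unset Strict Implicit.
Unset Printing Implicit Defensive.

Import Order.TTheory GRing.Theory Num.Theory.
Import numFieldNormedType.Exports.

(** * Paths of two involutions *)

(** Join two tetrahedra when they share a tricolour face. A tetrahedron has no tricolour face or
    exactly two ([tetra_repeat], [tric_mate], [tric_fibre]), and a face bounds at most two
    tetrahedra ([zc_fibre]), so every component of this graph is a path or a cycle. A path can end
    only at a tricolour face on the surface of the cube ([zc_neighbour]), and the boundary colours
    allow only [f] and [f'] there ([tric_boundary0], [tric_boundaryN]). Hence the component of [f]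
    is a path that ends at [f']; [involution_path] is the abstract form of this parity argument.

    A walk on the graph that never turns back inside a tetrahedron is forced, which gives uniqueness
    and the length ([tricolour_walk_unique]). Continuous lines and walks correspond: a walk is drawn
    as a polyline through face centres ([walk_line_joining]), and every 3-colour line between the
    two centres is such a polyline ([joining_walk]). Injectivity of the curve follows because the
    inner part of a segment lies in the interior of its tetrahedron ([interior_unique]). *)

Section Mate.
Variables (D : finType) (X : eqType) (f : D -> X).
(** The default [x] makes an element that is alone in its fibre a fixed point. *)
Definition mate (x : D) : D := odflt x [pick y | (y != x) && (f y == f x)].

Lemma mate_img x : f (mate x) = f x.
Proof. by rewrite /mate; case: pickP => [y /andP[_ /eqP] | ]. Qed.

Lemma mate_neq x y : y != x -> f y = f x -> mate x != x.
Proof.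
move=> yx fyx; rewrite /mate; case: pickP => [z /andP[]//|/(_ y)].
by rewrite yx fyx eqxx.
Qed.

Hypothesis fibre_le2 : forall x y z,
  f x = f y -> f x = f z -> [\/ x = y, x = z | y = z].

Lemma mate_fibre x y : f y = f x -> y = x \/ y = mate x.
Proof.
move=> fyx; have [->|yx] := eqVneq y x; [by left|right].
have mx := mate_neq yx fyx.
case: (fibre_le2 (esym (mate_img x)) (esym fyx)) => // [e|e].
  by rewrite -e eqxx in mx.
by rewrite e eqxx in yx.
Qed.

Lemma mateK : involutive mate.
Proof.
move=> x; have [e|mx] := eqVneq (mate x) x; first by rewrite !e.
have := mate_neq (x := mate x) (y := x).
rewrite eq_sym mx mate_img => /(_ isT erefl) mmx.
case: (@mate_fibre x (mate (mate x))) => //; rewrite ?mate_img //.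
by move=> e; rewrite e eqxx in mmx.
Qed.
End Mate.

Section InvolutionPath.
Variables (D : finType) (a b : D -> D) (x0 x1 : D).
Hypotheses (aK : involutive a) (bK : involutive b) (a_neq : forall x, a x != x).
Hypothesis b0 : b x0 = x0.
Hypothesis b_fix : forall x, b x = x -> x = x0 \/ x = x1.

Let s x := b (a x).

(** On the cyclic orbit of [x0] under [s], of length [n], both involutions act as reflections: [b]
    sends index [i] to [n - i] and [a] sends it to [n - i.+1]. An odd [n] would give [a] a fixed
    point, so [n = m.*2], and [b] fixes index [m], which must be [x1]. Neither reflection identifies
    two distinct indices of the first half. *)
Lemma involution_path : exists m,
  [/\ 0 < m, iter m s x0 = x1,
      forall i k, i < m -> k < m ->
        iter i s x0 = iter k s x0 \/ iter i s x0 = a (iter k s x0) -> i = k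
    & forall i k, i <= m -> k <= m ->
        iter i s x0 = iter k s x0 \/ iter i s x0 = b (iter k s x0) -> i = k].
Proof.
have s_inj : injective s by move=> x y /(inv_inj bK)/(inv_inj aK).
pose n := fingraph.order s x0.
have n0 : 0 < n := fingraph.order_gt0 s x0.
have sn : iter n s x0 = x0 := iter_order s_inj x0.
have iter_inj i k : i < n -> k < n -> iter i s x0 = iter k s x0 -> i = k.
  by move=> ni nk e; rewrite -(findex_iter ni) e findex_iter.
have biter i : i <= n -> b (iter i s x0) = iter (n - i) s x0.
  elim: i => [|i IH] lin; first by rewrite subn0 sn.
  rewrite iterS {1}/s bK; apply: (inv_inj aK); rewrite aK; apply: (inv_inj bK).
  by rewrite IH ?(ltnW lin)// -[in LHS](subnSK lin) iterS.
have aiter i : i < n -> a (iter i s x0) = iter (n - i.+1) s x0.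
  by move=> lin; rewrite -biter // iterS {2}/s bK.
have [m nE] : exists m, n = m.*2.
  exists n./2; have := odd_double_half n;
    case: (boolP (odd n)) => [on|_ //] /esym nE.
  have := a_neq (iter n./2 s x0); rewrite aiter; last by lia.
  by rewrite (_ : n - _ = n./2) ?eqxx //; lia.
have m0 : 0 < m by lia.
exists m; split=> //.
- have := biter m; rewrite (_ : n - m = m); last by lia.
  move=> /(_ ltac:(lia))/b_fix[]// /(iter_inj m 0); lia.
- move=> i k im km [|]; first by apply: iter_inj; lia.
  by rewrite aiter; last lia; move=> /iter_inj; lia.
- move=> i k im km [|]; first by apply: iter_inj; lia.
  rewrite biter; last by lia.
  have [->|k0] := posnP k; first by rewrite subn0 sn => /(iter_inj i 0); lia.
  by move=> /iter_inj; lia.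
Qed.
End InvolutionPath.

(** * Darts and their mirror images *)

Lemma ord3P (i : 'I_3) : [\/ i = ax1, i = ax2 | i = ax3].
Proof.
by case: i => [[|[|[|]]]] //= h; [apply: Or31|apply: Or32|apply: Or33];
  apply: val_inj.
Qed.

Lemma forall_ord3 (Q : 'I_3 -> Prop) : Q ax1 -> Q ax2 -> Q ax3 -> forall i, Q i.
Proof. by move=> ? ? ? i; case: (ord3P i) => ->. Qed.

Section Darts.
Variable N : nat.

Definition dart := (tetra N * 'I_4)%type.
Implicit Types (t : tetra N) (x y : dart).

(** The rank of coordinate [i] in the chain of inequalities of [t]. *)
Definition pos t (i : 'I_3) : 'I_3 := (t.2^-1)%g i.

Lemma pos_inj t : injective (pos t). Proof. exact: perm_inj. Qed.

(** The vertex at which only inequality [m] is strict: coordinates of rank at least [m] are raised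
    by one. *)
Definition vtx t (m : 'I_4) : dcube N :=
  [ffun i => inord (t.1 i + (m <= pos t i))].

Lemma vtxE t m i : vtx t m i = (t.1 i + (m <= pos t i)) :> nat.
Proof. by rewrite ffunE inordK //; have := ltn_ord (t.1 i); lia. Qed.

Lemma vtx_inj t : injective (vtx t).
Proof.
move=> m m' e; apply: val_inj; have e' i :=
  congr1 (fun v : dcube N => val (v i)) e.
have : forall p : 'I_3, (m <= p) = (m' <= p).
  move=> p; have := e' (t.2 p); rewrite /= !vtxE /pos permK; lia.
move=> h; have := (h ax1, h ax2, h ax3, ltn_ord m, ltn_ord m') => /= -[[[[]]]];
  lia.
Qed.

(* Three times the centre of the face [x]. Along each coordinate the vertices *)
(* of a face take the values [(z + r) %/ 3] for [r = 0, 1, 2], so that [zc x] *)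
(* determines them.                                                           *)
Definition zc x : {ffun 'I_3 -> nat} :=
  [ffun i => 3 * x.1.1 i + (pos x.1 i + (pos x.1 i < x.2))].

Definition fvtx x (q : 'I_3) : dcube N := vtx x.1 (lift x.2 q).

Lemma fvtxE x q i : fvtx x q i = (zc x i + (2 - q)) %/ 3 :> nat.
Proof.
rewrite vtxE ffunE -addnA mulnC divnMDl //= /bump; congr (_ + _).
move: (pos x.1 i) x.2 q => [p +] [j +] [r +] /=.
by move: p j r => [|[|[|]]] // [|[|[|[|]]]] // [|[|[|]]].
Qed.

Lemma fvtx_zc x y : zc x = zc y -> fvtx x =1 fvtx y.
Proof.
by move=> e q; apply/ffunP => i; apply: val_inj; rewrite /= !fvtxE e.
Qed.

Lemma sum_fvtx x i : \sum_q (fvtx x q i : nat) = zc x i.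
Proof. by rewrite !big_ord_recr big_ord0 /= !fvtxE /=; lia. Qed.

Lemma dart_eq x y : x.2 = y.2 :> nat ->
  (forall i, x.1.1 i = y.1.1 i :> nat /\ pos x.1 i = pos y.1 i :> nat) -> x = y.
Proof.
case: x y => [[k r] j] [[k' r'] j'] /= ej e.
have -> : j = j' by apply: val_inj.
have -> : k = k' by apply/ffunP => i; apply: val_inj; case: (e i).
have -> // : r = r'.
by apply: invg_inj; apply/permP => i; apply: val_inj; case: (e i).
Qed.

(* [mirror x y] says that [y] is the face [x] seen from the tetrahedron on    *)
(* the other side. Crossing a face [j = 1, 2] swaps two consecutive           *)
(* coordinates in the order of the chain; crossing [j = 0] or [j = 3] rotates *)
(* the chain and changes the cube.                                            *)
Definition mirror_face (j : nat) := nth 0 [:: 3; 1; 2; 0] j.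

Definition mirror_pos (j p : nat) := nth 0 (nth [::]
  [:: [:: 2; 0; 1]; [:: 1; 0; 2]; [:: 0; 2; 1]; [:: 1; 2; 0]] j) p.

Definition mirror_at (jx jy px py kx ky : nat) :=
  [&& jy == mirror_face jx, py == mirror_pos jx px
  & ky + ((jx == 0) && (px == 0)) == kx + ((jx == 3) && (px == 2))].

Definition mirror x y := forall i,
  mirror_at x.2 y.2 (pos x.1 i) (pos y.1 i) (x.1.1 i) (y.1.1 i).

Lemma mirror_functional x y y' : mirror x y -> mirror x y' -> y = y'.
Proof.
move=> e e'; apply: dart_eq => [|i].
  by have /and3P[/eqP -> _ _] := e ax1; have /and3P[/eqP -> _ _] := e' ax1.
have /and3P[_ /eqP -> h] := e i; have /and3P[_ /eqP -> h'] := e' i; split=> //;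
  lia.
Qed.

Lemma pos3 t : [/\ pos t ax1 != pos t ax2 :> nat, pos t ax1 != pos t ax3 :> nat
  & pos t ax2 != pos t ax3 :> nat].
Proof. by split; apply/eqP => /val_inj/pos_inj. Qed.

(** Ranks and faces take finitely many values; once they are fixed, each case is linear arithmetic
    in the corners [k] and [l]. *)
Lemma zc_mirror_nat jx p1 p2 p3 jy q1 q2 q3 k1 k2 k3 l1 l2 l3 :
  jx < 4 -> p1 < 3 -> p2 < 3 -> p3 < 3 -> p1 != p2 -> p1 != p3 -> p2 != p3 ->
  jy < 4 -> q1 < 3 -> q2 < 3 -> q3 < 3 -> q1 != q2 -> q1 != q3 -> q2 != q3 ->
  3 * l1 + (q1 + (q1 < jy)) = 3 * k1 + (p1 + (p1 < jx)) ->
  3 * l2 + (q2 + (q2 < jy)) = 3 * k2 + (p2 + (p2 < jx)) ->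
  3 * l3 + (q3 + (q3 < jy)) = 3 * k3 + (p3 + (p3 < jx)) ->
  [&& jy == jx, (l1 == k1) && (q1 == p1), (l2 == k2) && (q2 == p2)
    & (l3 == k3) && (q3 == p3)] \/
  [/\ mirror_at jx jy p1 q1 k1 l1, mirror_at jx jy p2 q2 k2 l2
    & mirror_at jx jy p3 q3 k3 l3].
Proof.
case: p1 => [|[|[|]]] //; case: p2 => [|[|[|]]] //; case: p3 => [|[|[|]]] //.
all: case: jx => [|[|[|[|]]]] // _ _ _ _ _ _ _.
all: case: jy => [|[|[|[|]]]] // _.
all: case: q1 => [|[|[|]]] //; case: q2 => [|[|[|]]] //;
  case: q3 => [|[|[|]]] //.
all: move=> _ _ _ _ _ _; rewrite ?addn0 ?addn1 ?addn2 /= => e1 e2 e3.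
all: solve [exfalso; clear -e1; lia | exfalso; clear -e2; lia| exfalso; clear
  -e3; lia | left; lia | right; rewrite /mirror_at /=; split; lia].
Qed.

Lemma zc_mirror x y : zc y = zc x -> y = x \/ mirror x y.
Proof.
move=> e; have ei i : zc y i = zc x i by rewrite e.
have [px1 px2 px3] := pos3 x.1; have [py1 py2 py3] := pos3 y.1.
have := (ei ax1, ei ax2, ei ax3); rewrite !ffunE => -[[e1 e2] e3].
have [] := zc_mirror_nat (ltn_ord _) (ltn_ord _) (ltn_ord _) (ltn_ord _)
  px1 px2 px3 (ltn_ord _) (ltn_ord _) (ltn_ord _) (ltn_ord _) py1 py2 py3 e1 e2
    e3.
  move=> /and4P[/eqP ? /andP[/eqP ? /eqP ?] /andP[/eqP ? /eqP ?] /andP[/eqP ?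
    /eqP ?]].
  by left; apply: dart_eq => //; apply: forall_ord3.
by move=> [? ? ?]; right; apply: forall_ord3.
Qed.

Lemma zc_fibre x y z : zc x = zc y -> zc x = zc z -> [\/ x = y, x = z | y = z].
Proof.
move=> /esym/zc_mirror[->|xy] /esym/zc_mirror[->|xz];
  try by [apply: Or31|apply: Or32].
by apply: Or33; apply: mirror_functional xy xz.
Qed.

End Darts.

(** * Neighbouring tetrahedra and tricolour faces *)

Section Tricolour.
Variable N : nat.
Implicit Types (t : tetra N) (x y : dart N).

Lemma posK t (p : 'I_3) : pos t (t.2 p) = p.
Proof. by rewrite /pos permK. Qed.

Lemma mirror_zc x y : mirror x y -> zc y = zc x.
Proof.
move=> xy; apply/ffunP => i; rewrite !ffunE; have := xy i; rewrite /mirror_at.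
move: x.2 (pos x.1 i) => [jx +] [p +] /=.
by move: jx p => [|[|[|[|]]]] // [|[|[|]]] //= _ _ /and3P[/eqP -> /eqP ->
  /eqP]; rewrite /mirror_pos /=; lia.
Qed.

Lemma mirror_neq x y : mirror x y -> y != x.
Proof.
move=> xy; apply/eqP => yx; move: xy; rewrite {}yx => xx.
(* The chosen rank is moved by the crossing: rank 1 for face 2, rank 0 for the other faces. *)
have := xx (x.1.2 (if x.2 == 2 :> nat then ax2 else ax1)).
rewrite posK /mirror_at; case/and3P.
by move: x.2 => [[|[|[|[|]]]]].
Qed.

(** The two hypotheses keep the mirror dart inside the cube: only crossing face 0 lowers a corner
    coordinate, and only crossing face 3 raises one. *)
Lemma zc_neighbour x :
  (forall i, x.2 = 0 :> nat -> pos x.1 i = 0 :> nat -> 0 < x.1.1 i) ->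
  (forall i, x.2 = 3 :> nat -> pos x.1 i = 2 :> nat -> (x.1.1 i).+1 < N) ->
  exists2 y, y != x & zc y = zc x.
Proof.
move=> h0 h3.
pose f (p : 'I_3) : 'I_3 := inord (mirror_pos x.2 p).
have fE p : f p = mirror_pos x.2 p :> nat.
  rewrite inordK //; case: x.2 p => [[|[|[|[|]]]] //= ?] [[|[|[|]]]] //.
have f_inj : injective f.
  move=> p q /(congr1 val) /=; rewrite !fE => e; apply: val_inj; move: e => /=.
  by case: x.2 p q => [[|[|[|[|]]]] //= ?] [[|[|[|]]] //= ?] [[|[|[|]]]].
pose k i := x.1.1 i + ((x.2 == 3 :> nat) && (pos x.1 i == 2 :> nat))
  - ((x.2 == 0 :> nat) && (pos x.1 i == 0 :> nat)).
have kN i : k i < N.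
  by have := (h3 i, ltn_ord (x.1.1 i)) => -[]; rewrite /k; lia.
pose y : dart N := ([ffun i => Ordinal (kN i)], ((x.1.2)^-1 * perm f_inj)^-1,
   inord (mirror_face x.2))%g.
suff xy : mirror x y by exists y; [exact: mirror_neq xy|exact: mirror_zc].
move=> i; apply/and3P; split.
- by rewrite inordK //; case: x.2 => [[|[|[|[|]]]]].
- by rewrite /pos /= invgK permM permE fE.
- by have := h0 i; rewrite ffunE /= /k; lia.
Qed.

Variable u : dcube N -> colour.

Definition tric x := [forall c, exists q, u (fvtx x q) == c].

Lemma tricP x : reflect (forall c, exists q, u (fvtx x q) = c) (tric x).
Proof.
apply: (iffP forallP) => h c; have := h c.
  by move=> /existsP[q /eqP]; exists q.
by move=> [q e]; apply/existsP; exists q; apply/eqP.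
Qed.

Lemma tric_zc x y : zc x = zc y -> tric x = tric y.
Proof.
move=> /fvtx_zc e; apply: eq_forallb => c; apply: eq_existsb => q.
by rewrite e.
Qed.

Lemma tric_lift (t : tetra N) (j : 'I_4) :
  reflect (forall c, exists2 m, m != j & u (vtx t m) = c) (tric (t, j)).
Proof.
apply: (iffP (tricP _)) => h c; have := h c.
  by move=> [q e]; exists (lift j q) => //; rewrite eq_sym neq_lift.
by move=> [m mj e]; move: mj e; rewrite eq_sym => /unlift_some[q -> _] e;
  exists q.
Qed.

(* The face [(t, j)] omits the vertex [vtx t j]. *)
Lemma tetra_repeat (t : tetra N) : exists a b : 'I_4, [/\ a != b,
  u (vtx t a) = u (vtx t b) & forall j, tric (t, j) -> j = a \/ j = b].
Proof.
have /injectivePn[a [b ab e]] : ~~ injectiveb (fun m => u (vtx t m)).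
  apply/negP => /injectiveP/leq_card; by rewrite !card_ord.
exists a, b; split=> // j /tric_lift h; apply: contrapT => /not_orP[ja jb].
suff : [set: colour]%SET \subset
    ((fun m => u (vtx t m)) @: (~: [set j; a]))%SET.
  move=> /subset_leq_card; rewrite cardsT card_ord =>
    /leq_trans/(_ (leq_imset_card _ _)).
  have := cardsC [set j; a]%SET; rewrite cards2 card_ord.
  by move/eqP: ja => ->; lia.
apply/fintype.subsetP => c _; have [m mj <-] := h c; have [ma|ma] := eqVneq m a.
  apply/imsetP; exists b; last by rewrite ma.
  by rewrite !inE; apply/norP; split; apply/eqP;
    [exact: nesym|move=> ba; rewrite ba eqxx in ab].
by apply/imsetP; exists m; rewrite // !inE; apply/norP.
Qed.

(** Omitting either of two equally coloured vertices leaves the same set of colours. *)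
Lemma tric_mate t j : tric (t, j) -> exists2 j', j' != j & tric (t, j').
Proof.
move=> tj; have [a [b [ab e h]]] := tetra_repeat t.
suff sw a' b' : a' != b' -> u (vtx t a') = u (vtx t b') -> tric (t, a') ->
  tric (t, b').
  case: (h j tj) => ej; rewrite ej in tj *.
    by exists b; [rewrite eq_sym|exact: sw tj].
  by exists a => //; apply: sw tj => //; rewrite eq_sym.
move=> {ab e}ab e /tric_lift ha; apply/tric_lift => c; have [m ma <-] := ha c.
have [->|mb] := eqVneq m b'; first by exists a'.
by exists m.
Qed.

Lemma tric_fibre x y z : tric x -> tric y -> tric z -> x.1 = y.1 -> x.1 = z.1 ->
  [\/ x = y, x = z | y = z].
Proof.
case: x y z => [t j] [t' j'] [t'' j''] /= hx hy hz e' e'';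
  rewrite -{}e' -{}e'' in hy hz *.
have [a [b [_ _ h]]] := tetra_repeat t.
case: (h j hx) => ->; case: (h j' hy) => ->; case: (h j'' hz) => ->;
  by [apply: Or31|apply: Or32|apply: Or33].
Qed.

End Tricolour.

(** * Tricolour faces on the boundary *)

Definition dobrushin_colouring (N : nat) (u : dcube N -> colour) : Prop :=
  [/\ forall v, v \in boundary0 N -> u v = colour0,
      forall v, v \in boundary1 N -> u v = colour1
    & forall v, v \in boundary2 N -> u v = colour2].

Section Boundary.
Variable N : nat.
Hypothesis hN : 0 < N.
Variable u : dcube N -> colour.
Hypothesis hu : dobrushin_colouring u.
Implicit Types (v : dcube N) (t : tetra N) (x y : dart N).

Lemma forallb_ord3 (Q : pred 'I_3) :
  [forall i, Q i] = [&& Q ax1, Q ax2 & Q ax3].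
Proof.
apply/forallP/and3P => [h|[h1 h2 h3]]; first by split.
exact: forall_ord3.
Qed.

Lemma coord_ltN v i : (v i < N) = (v i != N :> nat).
Proof. by have := ltn_ord (v i); lia. Qed.

Lemma coord_0N v i : (v i == 0 :> nat) && (v i == N :> nat) = false.
Proof. by lia. Qed.

(** Membership depends only on which coordinates equal 0 or [N], so six booleans decide it; this
    form is linear arithmetic. *)
Lemma boundary0E v : (v \in boundary0 N) =
  ((v ax1 == 0 :> nat) && [|| 0 < v ax3, v ax2 == 0 :> nat | v ax2 == N :> nat])
  || (v ax2 == N :> nat).
Proof.
rewrite /boundary0 !inE !forallb_ord3 -!val_eqE /= !lt0n !coord_ltN.
have := (coord_0N v ax1, coord_0N v ax2, coord_0N v ax3) => -[[]].
by do 6!case: (_ == _).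
Qed.

Lemma boundary1E v : (v \in boundary1 N) =
  [&& v ax3 == N :> nat, 0 < v ax1 & v ax2 < N]
  || [&& v ax2 == 0 :> nat, 0 < v ax1 < N & 0 < v ax3].
Proof.
rewrite /boundary1 !inE !forallb_ord3 -!val_eqE /= !lt0n !coord_ltN.
have := (coord_0N v ax1, coord_0N v ax2, coord_0N v ax3) => -[[]].
by do 6!case: (_ == _).
Qed.

Lemma boundary2E v : (v \in boundary2 N) =
  [&& v ax3 == 0 :> nat, v ax2 < N & (0 < v ax1) || (0 < v ax2)]
  || [&& v ax1 == N :> nat, v ax2 < N & v ax3 < N].
Proof.
rewrite /boundary2 !inE !forallb_ord3 -!val_eqE /= !lt0n !coord_ltN.
have := (coord_0N v ax1, coord_0N v ax2, coord_0N v ax3) => -[[]].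
by do 6!case: (_ == _).
Qed.

Lemma notin_boundary v c : u v = c ->
  [/\ c != colour0 -> v \notin boundary0 N, c != colour1 -> v \notin boundary1 N
     & c != colour2 -> v \notin boundary2 N].
Proof.
by have [h0 h1 h2] := hu; move=> <-; split; apply: contra => /[dup];
  [move=> /h0|move=> /h1|move=> /h2] => ->.
Qed.

(** Four sides of the cube miss a colour and so contain no tricolour face; the sides [ax2 = 0] and
    [ax1 = N] remain. *)
Lemma colour_planes v :
  [/\ v ax1 = 0 :> nat \/ v ax2 = N :> nat \/ v ax3 = 0 :> nat -> u v <> colour1
     & v ax3 = N :> nat -> u v <> colour2].
Proof.
split=> h /notin_boundary; rewrite !boundary0E !boundary1E !boundary2E;
  last first.
  by move=> [/(_ isT) ? /(_ isT) ? _]; have := ltn_ord (v ax2); lia.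
move=> [/(_ isT) + _ /(_ isT)]; have := ltn_ord (v ax2); lia.
Qed.

Lemma colour_plane2 v : v ax2 = 0 :> nat ->
  [/\ u v = colour0 -> v ax1 = 0 :> nat,
      u v = colour1 -> 0 < v ax1 /\ 0 < v ax3
    & u v = colour2 -> 0 < v ax1 /\
        (v ax3 = 0 :> nat \/ v ax1 = N :> nat /\ v ax3 < N)].
Proof.
move=> h; have := (ltn_ord (v ax1), ltn_ord (v ax3)) => -[a c].
split=> /notin_boundary; rewrite !boundary0E !boundary1E !boundary2E h /=;
  move=> [/(_ isT)+ /(_ isT)+ _] || move=> [/(_ isT) + _ /(_ isT)]
    || move=> [_ /(_ isT)+ /(_ isT)]; lia.
Qed.

Lemma colour_plane1 v : v ax1 = N :> nat ->
  [/\ u v = colour0 -> v ax2 = N :> nat,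
      u v = colour1 -> v ax2 < N /\ v ax3 = N :> nat
    & u v = colour2 -> v ax2 < N /\ v ax3 < N].
Proof.
move=> h; have := (ltn_ord (v ax2), ltn_ord (v ax3)) => -[b c].
split=> /notin_boundary; rewrite !boundary0E !boundary1E !boundary2E h /=;
  move=> [/(_ isT)+ /(_ isT)+ _] || move=> [/(_ isT) + _ /(_ isT)]
    || move=> [_ /(_ isT)+ /(_ isT)]; lia.
Qed.

(* Three times the centres of the triangles [f] and [f']. *)
Definition zc_start : {ffun 'I_3 -> nat} :=
  [ffun i => nth 0 [:: 2; 0; 1] (val i)].
Definition zc_end : {ffun 'I_3 -> nat} :=
  [ffun i => 3 * N - nth 0 [:: 0; 2; 1] (val i)].

(** The face lies in a side where coordinate [i] is 0. If [i] is [ax2], colour 0 occurs only on the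
    edge [ax1 = 0], while colours 1 and 2 need [ax1 > 0]; colour 1 needs [ax3 > 0], and one step
    from that edge colour 2 needs [ax3 = 0]. This forces the triangle [f]. *)
Lemma tric_boundary0 x i : tric u x ->
  x.2 = 0 :> nat -> pos x.1 i = 0 :> nat -> x.1.1 i = 0 :> nat ->
  zc x = zc_start.
Proof.
move=> /tricP h ej ep ek.
have vE q i' : fvtx x q i' = x.1.1 i' + (q < pos x.1 i') :> nat.
  by rewrite vtxE /= /bump ej.
have v0 q : fvtx x q i = 0 :> nat by rewrite vE ek ep.
have [q1 e1] := h colour1.
have [p12 p13 p23] := pos3 x.1.
move: i ek ep v0; apply: forall_ord3 => ek ep v0.
- by have [/(_ (or_introl _ (v0 q1)))] := colour_planes (fvtx x q1).
- have [q0 e0] := h colour0; have [q2 e2] := h colour2.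
  have [/(_ e0) + _ _] := colour_plane2 (v0 q0).
  have [_ /(_ e1) + _] := colour_plane2 (v0 q1).
  have [_ _ /(_ e2)] := colour_plane2 (v0 q2).
  rewrite !vE => h2 h1 h0; apply/ffunP; apply: forall_ord3;
    rewrite !ffunE /= ej ?ep ?ek //.
    move: (ltn_ord (pos x.1 ax1)) (ltn_ord (pos x.1 ax3)) (ltn_ord (x.1.1 ax3));
      lia.
  move: (ltn_ord (pos x.1 ax1)) (ltn_ord (pos x.1 ax3)) (ltn_ord (x.1.1 ax3));
    lia.
- by have [/(_ (or_intror _ (or_intror _ (v0 q1))))] :=
  colour_planes (fvtx x q1).
Qed.

(** In the side [ax1 = N], colour 0 occurs only on the edge [ax2 = N]; off that edge, colour 1 needs
    [ax3 = N] and colour 2 needs [ax3 < N]. This forces the triangle [f']. *)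
Lemma tric_boundaryN x i : tric u x ->
  x.2 = 3 :> nat -> pos x.1 i = 2 :> nat -> (x.1.1 i).+1 = N -> zc x = zc_end.
Proof.
move=> /tricP h ej ep ek.
have vE q i' : fvtx x q i' = x.1.1 i' + (q <= pos x.1 i') :> nat.
  by rewrite vtxE /= /bump ej; have := ltn_ord q; lia.
have v0 q : fvtx x q i = N :> nat by rewrite vE ep; have := ltn_ord q; lia.
have [q1 e1] := h colour1; have [q2 e2] := h colour2.
have [p12 p13 p23] := pos3 x.1.
move: i ek ep v0; apply: forall_ord3 => ek ep v0.
- have [q0 e0] := h colour0.
  have [/(_ e0) + _ _] := colour_plane1 (v0 q0).
  have [_ /(_ e1) + _] := colour_plane1 (v0 q1).
  have [_ _ /(_ e2)] := colour_plane1 (v0 q2).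
  rewrite !vE => h2 h1 h0; apply/ffunP; apply: forall_ord3;
    rewrite !ffunE /= ej ?ep; first lia.
    move: (ltn_ord (pos x.1 ax2)) (ltn_ord (pos x.1 ax3)) (ltn_ord (x.1.1 ax3))
      (ltn_ord (x.1.1 ax2)); lia.
  move: (ltn_ord (pos x.1 ax2)) (ltn_ord (pos x.1 ax3)) (ltn_ord (x.1.1 ax3))
    (ltn_ord (x.1.1 ax2)); lia.
- by have [/(_ (or_intror _ (or_introl _ (v0 q1))))] :=
  colour_planes (fvtx x q1).
- by have [_ /(_ (v0 q2))] := colour_planes (fvtx x q2).
Qed.

End Boundary.

(** * The walk from [f] to [f'] *)

Section Walk.
Variable N : nat.
Hypothesis hN : 0 < N.

Lemma ltn_predN : N.-1 < N. Proof. by rewrite prednK. Qed.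

(** The order [x2 <= x3 <= x1], shared by the tetrahedra that carry [f] and [f']. *)
Definition rot_axes : {perm 'I_3} := perm (@addrI 'I_3 (1 : 'I_3)%R).

Definition dart_start : dart N :=
  (([ffun=> Ordinal hN], rot_axes), ord0).
Definition dart_end : dart N :=
  (([ffun=> Ordinal ltn_predN], rot_axes), ord_max).

Lemma pos_rot_axes (k : {ffun 'I_3 -> 'I_N}) i :
  pos (k, rot_axes) i = nth 0 [:: 2; 0; 1] i :> nat.
Proof.
have -> : pos (k, rot_axes) i = (i - 1)%R.
  by rewrite /pos /=; apply: (@perm_inj _ rot_axes);
    rewrite permKV permE addrC subrK.
by case: (ord3P i) => ->.
Qed.

Lemma zc_dart_start : zc dart_start = zc_start.
Proof.
by apply/ffunP; apply: forall_ord3; rewrite !ffunE !pos_rot_axes.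
Qed.

Lemma zc_dart_end : zc dart_end = zc_end N.
Proof.
by apply/ffunP; apply: forall_ord3; rewrite !ffunE !pos_rot_axes /=; lia.
Qed.

(** A mirror dart would have a corner coordinate equal to -1. *)
Lemma zc_start_unique x : zc x = zc_start -> x = dart_start.
Proof.
rewrite -zc_dart_start => /zc_mirror[//|/(_ ax2)].
by rewrite /mirror_at !pos_rot_axes ffunE /= => /and3P[_ _]; lia.
Qed.

Lemma zc_end_unique x : zc x = zc_end N -> x = dart_end.
Proof.
rewrite -zc_dart_end => /zc_mirror[//|/(_ ax1)].
rewrite /mirror_at !pos_rot_axes ffunE /= => /and3P[_ _].
by have := ltn_ord (x.1.1 ax1); lia.
Qed.

Variable u : dcube N -> colour.
Hypothesis hu : dobrushin_colouring u.

Lemma tric_start : tric u dart_start.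
Proof.
have [h0 h1 h2] := hu; apply/tricP; apply: forall_ord3.
- exists ax3; apply: h0; rewrite (boundary0E hN) !fvtxE zc_dart_start !ffunE
  /=; lia.
- exists ax1; apply: h1; rewrite (boundary1E hN) !fvtxE zc_dart_start !ffunE
  /=; lia.
- exists ax2; apply: h2; rewrite (boundary2E hN) !fvtxE zc_dart_start !ffunE
  /=; lia.
Qed.

Lemma tric_end : tric u dart_end.
Proof.
have [h0 h1 h2] := hu; apply/tricP; apply: forall_ord3.
- exists ax1; apply: h0; rewrite (boundary0E hN) !fvtxE zc_dart_end !ffunE /=;
  lia.
- exists ax2; apply: h1; rewrite (boundary1E hN) !fvtxE zc_dart_end !ffunE /=;
  lia.
- exists ax3; apply: h2; rewrite (boundary2E hN) !fvtxE zc_dart_end !ffunE /=;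
  lia.
Qed.

Lemma tric_neighbour x : tric u x -> zc x <> zc_start -> zc x <> zc_end N ->
  exists2 y, y != x & zc y = zc x.
Proof.
move=> ux xs xe; apply: zc_neighbour => i ej ep.
  by rewrite lt0n; apply/eqP => /(tric_boundary0 hN hu ux ej ep).
rewrite ltn_neqAle ltn_ord andbT; apply/eqP.
by move=> /(tric_boundaryN hN hu ux ej ep).
Qed.

(** The discrete trace of a 3-colour line: [t j] carries segment [j], which runs between the points
    with tripled coordinates [c j] and [c j.+1]. *)
Definition tricolour_walk (L : nat) (t : nat -> tetra N)
    (c : nat -> {ffun 'I_3 -> nat}) :=
  [/\ 0 < L,
      forall j, j < L -> exists x y, [/\ tric u x, tric u y, x != y,
        x.1 = t j /\ y.1 = t j & zc x = c j /\ zc y = c j.+1],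
      forall j, j.+1 < L -> t j != t j.+1, c 0 = zc_start & c L = zc_end N].

Lemma tricolour_walk_unique : exists m t c, [/\ tricolour_walk m t c,
  forall i k, i < m -> k < m -> t i = t k -> i = k,
  forall i k, i <= m -> k <= m -> c i = c k -> i = k &
  forall m' t' c', tricolour_walk m' t' c' ->
    m' = m /\ forall j, j <= m -> c' j = c j].
Proof.
pose D := {x : dart N | tric u x}.
pose tet (x : D) := (val x).1; pose ctr (x : D) := zc (val x).
pose a := mate tet; pose b := mate ctr.
have tet_fib x y z : tet x = tet y -> tet x = tet z ->
  [\/ x = y, x = z | y = z].
  move=> xy xz; case: (tric_fibre (valP x) (valP y) (valP z) xy xz) => /val_inj;
    by [apply: Or31|apply: Or32|apply: Or33].
have ctr_fib x y z : ctr x = ctr y -> ctr x = ctr z ->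
  [\/ x = y, x = z | y = z].
  move=> xy xz; case: (zc_fibre xy xz) => /val_inj;
    by [apply: Or31|apply: Or32|apply: Or33].
have a_neq x : a x != x.
  case: x => -[t j] utj; have [j' jj' utj'] := tric_mate utj.
  apply: (@mate_neq _ _ tet _ (exist _ (t, j') utj')) => //.
  by rewrite -val_eqE /= -pair_eqE /pair_eq /= (negbTE jj') andbF.
pose x0 : D := exist _ dart_start tric_start.
pose x1 : D := exist _ dart_end tric_end.
have ctr0 x : ctr x = zc_start -> x = x0 by move=> h;
  apply/val_inj/zc_start_unique.
have ctr1 x : ctr x = zc_end N -> x = x1 by move=> h;
  apply/val_inj/zc_end_unique.
have b0 : b x0 = x0 by apply: ctr0; rewrite [ctr _]mate_img;
  exact: zc_dart_start.
have b_fix x : b x = x -> x = x0 \/ x = x1.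
  move=> bx; apply: contrapT => /not_orP[nx0 nx1].
  have [||y yx yxc] := tric_neighbour (valP x); [by move/ctr0|by move/ctr1|].
  have uy : tric u y by rewrite (tric_zc u yxc) (valP x).
  have := @mate_neq _ _ ctr x (exist _ y uy).
  by rewrite -val_eqE /= yx => /(_ isT yxc); rewrite -/b bx eqxx.
have [m [m0 mx1 tet_inj ctr_inj]] :=
  involution_path (mateK tet_fib) (mateK ctr_fib) a_neq b0 b_fix.
pose s x := b (a x); pose e i := iter i s x0.
have ctr_s x : ctr (s x) = ctr (a x) by exact: mate_img.
have tet_a x : tet (a x) = tet x by exact: mate_img.
have inj1 i k : i < m -> k < m -> tet (e i) = tet (e k) -> i = k.
  by move=> im km /(mate_fibre tet_fib); exact: tet_inj.
have inj2 i k : i <= m -> k <= m -> ctr (e i) = ctr (e k) -> i = k.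
  by move=> im km /(mate_fibre ctr_fib); exact: ctr_inj.
exists m, (fun i => tet (e i)), (fun i => ctr (e i)); split => //.
  split=> //; last 2 first.
  - exact: zc_dart_start.
  - by rewrite [e m]mx1; exact: zc_dart_end.
  - move=> j jm; exists (val (e j)), (val (a (e j))).
    split; rewrite ?(valP (e j)) ?(valP (a (e j))) //.
    + by rewrite val_eqE eq_sym.
    + by rewrite -/(tet (a (e j))) tet_a.
    + by split=> //; rewrite -[e j.+1]/(s (e j)) ctr_s.
  - by move=> j jm; apply/eqP => /inj1; lia.
move=> m' t' c' [m0' w t_neq c0 cm].
(* The dart by which the walk enters its [j]-th tetrahedron is forced: the exit dart is the [a]-mate
   of the entrance, and since the tetrahedron changes, the next entrance is the [b]-mate of the
   exit. *)
have ent j : j < m' -> forall x : D, tet x = t' j -> ctr x = c' j -> x = e j.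
  elim: j => [|j IH] jm x tx cx; first by apply: ctr0; rewrite cx.
  have [xj [yj [ux uy xy [xt yt] [xc yc]]]] := w j (ltnW jm).
  have ej := IH (ltnW jm) (exist _ xj ux) xt xc.
  have yE : exist _ yj uy = a (e j).
    have [] := @mate_fibre _ _ tet tet_fib (e j) (exist _ yj uy).
    - by rewrite -ej /tet /= yt.
    - by move=> yx; rewrite -yx in ej; case: ej => ej; rewrite ej eqxx in xy.
    - by [].
  have [] := @mate_fibre _ _ ctr ctr_fib (a (e j)) x.
  - by rewrite -yE cx -yc.
  - by move=> xE; move: (t_neq _ jm); rewrite -tx xE tet_a -ej /tet /= xt eqxx.
  - by [].
have next j : j < m' -> c' j = ctr (e j) /\
    exists2 y : D, y = a (e j) & tet y = t' j /\ ctr y = c' j.+1.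
  move=> jm; have [xj [yj [ux uy xy [xt yt] [xc yc]]]] := w j jm.
  have ej := ent j jm (exist _ xj ux) xt xc.
  split; first by rewrite -ej.
  exists (exist _ yj uy) => //.
  have [] := @mate_fibre _ _ tet tet_fib (e j) (exist _ yj uy) => //.
  - by rewrite -ej /tet /= yt.
  - by move=> yx; rewrite -yx in ej; case: ej => ej; rewrite ej eqxx in xy.
have cE j : j <= m' -> c' j = ctr (e j).
  rewrite leq_eqVlt => /orP[/eqP ->|/next[]//].
  have [_ [y ya [_ yc]]] := next m'.-1 (ltac:(lia)).
  by rewrite -[in LHS](prednK m0') -yc ya -ctr_s -[s _]/(e m'.-1.+1) prednK.
have mm' : m' = m.
  (* A longer walk would pass through [f'] at time [m]; no other dart has this centre, so it would
     stay in the same tetrahedron. *)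
  have [lt_mm'|le_m'm] := ltnP m m'.
    have [_ [y ya [yt yc]]] := next m.-1 (ltac:(lia)).
    have [_ [z za [zt _]]] := next m lt_mm'.
    have ym : y = e m by rewrite [e m]mx1; apply: ctr1;
      rewrite yc prednK // cE ?(ltnW lt_mm')// [e m]mx1 /ctr /= zc_dart_end.
    have := t_neq m.-1; rewrite prednK // => /(_ lt_mm').
    by rewrite -yt -zt za tet_a ym eqxx.
  apply: inj2 => //; rewrite -cE // cm [e m]mx1; exact/esym/zc_dart_end.
by split=> // j jm; rewrite cE // mm'.
Qed.

End Walk.

(** * Geometry of the tetrahedra *)

Local Open Scope classical_set_scope.
Local Open Scope ring_scope.

Section Geometry.
Variables (R : realType) (N : nat).
Implicit Types (t : tetra N) (x y : dart N) (p q : 'rV[R]_3).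

Definition level t p (l : nat) : R := (chain t.2 (p - latt R t.1))`_l.

Lemma levelE t p (l : 'I_3) : level t p l.+1 = p 0 (t.2 l) - (t.1 (t.2 l))%:R.
Proof. by rewrite /level; case: (ord3P l) => -> /=; rewrite !mxE. Qed.

Lemma level0 t p : level t p 0 = 0. Proof. by []. Qed.
Lemma level4 t p : level t p 4 = 1. Proof. by []. Qed.

Lemma tetra_partP t E p : tetra_part t E p <-> forall j : 'I_4,
  level t p j <= level t p j.+1 /\ (j \in E -> level t p j = level t p j.+1).
Proof.
split=> [[x hx <-] j|h]; first by have := hx j;
  rewrite /level [latt _ _ + x]addrC addrK.
by exists (p - latt R t.1); rewrite // addrC subrK.
Qed.

Lemma row_level t p q : (forall l : 'I_3, level t p l.+1 = level t q l.+1) ->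
  p = q.
Proof.
move=> h; apply/rowP => i; have := h (pos t i).
by rewrite !levelE /pos permKV => /addIr.
Qed.

Lemma level_vtx t m (l : nat) : (l <= 4)%N ->
  level t (latt R (vtx t m)) l = (m < l)%N%:R.
Proof.
case: l => [|l] l4; first by rewrite level0.
have [l3|l3] := ltnP l 3; last first.
  by rewrite (_ : l = 3%N) ?level4 ?(ltn_ord m)//; lia.
rewrite (levelE t _ (Ordinal l3)) mxE vtxE natrD addrAC subrr add0r /pos.
by rewrite permK.
Qed.

Lemma vtx_part t m E : tetra_part t E (latt R (vtx t m)) <-> m \notin E.
Proof.
rewrite tetra_partP; split.
  have m4 := ltn_ord m; move=> /(_ m)[_];
    rewrite !level_vtx ?(ltnW m4) // ltnn ltnSn.
  by move=> h; apply/negP => /h /eqP; rewrite eq_sym oner_eq0.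
move=> mE j; rewrite !level_vtx // ?(ltnW (ltn_ord j)) // ler_nat; split;
  first by lia.
move=> jE; congr (_%:R); have : m != j :> nat by apply: contraNneq mE =>
  /val_inj ->.
by rewrite ltnS [in RHS]leq_eqVlt => /negbTE ->.
Qed.

(** Equalities propagate the level 0 upwards to index [m] and the level 1 downwards from index 4. *)
Lemma part_vtx t m : tetra_part t (~: [set m])%SET = [set latt R (vtx t m)].
Proof.
apply/seteqP; split=> [p|p ->]; last by apply/vtx_part; rewrite !inE eqxx.
move=> /tetra_partP h; apply: (@row_level t) => l.
have {h}step j : (j < 4)%N -> j != m -> level t p j = level t p j.+1.
  move=> j4 jm; apply: (h (Ordinal j4)).2; rewrite !inE; exact: jm.
have lo j : (j <= m)%N -> level t p j = 0.
  by elim: j => // j IH jm; rewrite -step ?IH //; have := ltn_ord m; lia.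
have hi j : (j <= 3 - m)%N -> level t p (4 - j) = 1.
  elim: j => [_|j IH jm]; first exact: level4.
  have jE : ((4 - j.+1).+1 = 4 - j)%N by lia.
  by rewrite step ?jE; [apply: IH; lia | lia | lia].
have := (ltn_ord l, ltn_ord m) => -[l3 m4]; rewrite level_vtx ?ltnS;
  last by lia.
case: leqP => lm; last by rewrite lo.
have -> : (l.+1 = 4 - (3 - l))%N by lia.
by apply: hi; lia.
Qed.

Lemma is_vertexE t v : is_vertex R t v <-> exists m, v = vtx t m.
Proof.
split=> [[E E3 tE]|[m ->]]; last first.
  by exists (~: [set m])%SET; [rewrite cardsC1 card_ord|exact: part_vtx].
have /cards1P[m Em] : #|~: E| == 1%N by have := cardsC E; rewrite E3 card_ord;
  lia.
exists m; have : [set latt R v] (latt R (vtx t m)).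
  by rewrite -tE vtx_part -finset.in_setC Em inE.
move=> e; apply/ffunP => i; apply/val_inj/eqP; rewrite -(eqr_nat R).
by have := congr1 (fun q : 'rV[R]_3 => q 0 i) e; rewrite !mxE => ->.
Qed.

Lemma face_verticesP t j v :
  reflect (exists q : 'I_3, v = fvtx (t, j) q) (v \in face_vertices R t j).
Proof.
rewrite inE; apply: (iffP (asboolP _)) => [[/is_vertexE[m ->]]|[q ->]].
  rewrite vtx_part inE eq_sym => /unlift_some[q -> _]; by exists q.
split; first by apply/is_vertexE; exists (lift j q).
by rewrite vtx_part inE eq_sym neq_lift.
Qed.

Lemma tricolourE (u : dcube N -> colour) t j :
  tricolour R u t j <-> tric u (t, j).
Proof.
split=> [h|/tricP h c].
  by apply/tricP => c; have [v /face_verticesP[q ->]] := h c; exists q.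
by have [q qc] := h c; exists (fvtx (t, j) q) => //; apply/face_verticesP;
  exists q.
Qed.

Definition centre (z : {ffun 'I_3 -> nat}) : 'rV[R]_3 := \row_i ((z i)%:R / 3).

Lemma face_centreE t j : face_centre R t j = centre (zc (t, j)).
Proof.
have fE : face_vertices R t j = [set fvtx (t, j) q | q : 'I_3]%SET.
  apply/setP => v; apply/face_verticesP/imsetP => [[q ->]|[q _ ->]];
    by exists q.
rewrite /face_centre fE big_imset /=; last by move=> q q' _ _ /vtx_inj/lift_inj.
apply/rowP => i; rewrite !mxE summxE -sum_fvtx natr_sum mulrC; congr (_ * _).
by apply: eq_bigr => q _; rewrite mxE.
Qed.

Lemma centre_inj : injective centre.
Proof.
move=> z z' e; apply/ffunP => i; apply/eqP; rewrite -(eqr_nat R); apply/eqP.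
have := congr1 (fun q : 'rV[R]_3 => q 0 i) e; rewrite !mxE; lra.
Qed.

(** Vertex [m] has level 1 at [l] when [m < l], and the centre averages this over the vertices other
    than [x.2]. *)
Lemma level_centre x (l : nat) : (l <= 4)%N ->
  level x.1 (centre (zc x)) l = (l - (x.2 < l))%N%:R / 3.
Proof.
case: l => [|l] l4; first by rewrite level0 mul0r.
have [l3|l3] := ltnP l 3; last first.
  have -> : l = 3%N by lia.
  by rewrite level4 (ltn_ord x.2) divff // pnatr_eq0.
rewrite (levelE x.1 _ (Ordinal l3)) mxE ffunE posK natrD natrM /=.
rewrite (_ : l.+1 - _ = l + (l < x.2))%N; last by lia.
lra.
Qed.

Lemma level_affine t p q s l : (l <= 4)%N ->
  level t ((1 - s) *: p + s *: q) l = (1 - s) * level t p l + s * level t q l.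
Proof.
case: l => [|l] l4; first by rewrite !level0; lra.
have [l3|l3] := ltnP l 3; last first.
  by have -> : l = 3%N by [lia]; rewrite !level4; lra.
by rewrite !(levelE t _ (Ordinal l3)) !mxE; lra.
Qed.

Lemma tetra_coord t p i : (forall j : 'I_4, level t p j <= level t p j.+1) ->
  0 <= p 0 i - (t.1 i)%:R <= 1.
Proof.
move=> le_t.
have [] := And4 (le_t (inord 0)) (le_t (inord 1)) (le_t (inord 2))
  (le_t (inord 3)).
rewrite !inordK // level0 level4 => le0 le1 le2 le3.
have := levelE t p (pos t i); rewrite /pos permKV => <-.
by case: (ord3P ((t.2)^-1%g i)) => -> /=; lra.
Qed.

Lemma interior_coord t p i : (forall j : 'I_4, level t p j < level t p j.+1) ->
  0 < p 0 i - (t.1 i)%:R < 1.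
Proof.
move=> lt_t.
have [] := And4 (lt_t (inord 0)) (lt_t (inord 1)) (lt_t (inord 2))
  (lt_t (inord 3)).
rewrite !inordK // level0 level4 => lt0 lt1 lt2 lt3.
have := levelE t p (pos t i); rewrite /pos permKV => <-.
by case: (ord3P ((t.2)^-1%g i)) => -> /=; lra.
Qed.

Lemma tetra_in_cube t p : (forall j : 'I_4, level t p j <= level t p j.+1) ->
  rcube N p.
Proof.
move=> /tetra_coord h i; have := h i.
have : (t.1 i)%:R + 1 <= N%:R :> R by rewrite natr1 ler_nat.
have : 0 <= (t.1 i)%:R :> R by [].
lra.
Qed.

(** The coordinates of [p] are strictly between consecutive integers, which gives the corner, and
    their fractional parts are distinct, so their order gives the permutation. *)
Lemma interior_unique t t' p :
  (forall j : 'I_4, level t p j < level t p j.+1) ->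
  (forall j : 'I_4, level t' p j <= level t' p j.+1) -> t = t'.
Proof.
move=> lt_t le_t'.
have ek : t.1 = t'.1.
  apply/ffunP => i; apply/val_inj/eqP => /=.
  have := interior_coord i lt_t; have :=
    tetra_coord i le_t' => {lt_t le_t'} le lt.
  by rewrite eqn_leq; apply/andP; split; rewrite -ltnS -(ltr_nat R) -natr1; lra.
have lt_level (l l' : 'I_3) : (l < l')%N -> level t p l.+1 < level t p l'.+1.
  have := lt_t (inord 1); have := lt_t (inord 2);
    rewrite !inordK // => {le_t' lt_t ek} h1 h2.
  by case: (ord3P l) => ->; case: (ord3P l') => -> //= _; lra.
have le_pos (l l' : 'I_3) : level t' p l.+1 <= level t' p l'.+1 ->
    (pos t (t'.2 l) <= pos t (t'.2 l'))%N.
  rewrite !levelE -ek leNgt => lev; rewrite leqNgt;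
    apply: contra lev => /lt_level.
  by rewrite !levelE /pos !permKV.
(* A monotone permutation of three ranks is the identity. *)
have pos_id l : pos t (t'.2 l) = l.
  have := le_t' (inord 1); have := le_t' (inord 2); rewrite !inordK //.
  move=> /(le_pos ax2 ax3) h23 /(le_pos ax1 ax2) h12.
  have n12 : pos t (t'.2 ax1) != pos t (t'.2 ax2) :> nat by apply/eqP =>
    /val_inj/pos_inj/perm_inj.
  have n23 : pos t (t'.2 ax2) != pos t (t'.2 ax3) :> nat by apply/eqP =>
    /val_inj/pos_inj/perm_inj.
  have := ltn_ord (pos t (t'.2 ax3)).
  by move=> {lt_level le_pos lt_t le_t'} lt3; apply: val_inj;
    case: (ord3P l) => -> /=; lia.
have er : t.2 = t'.2 by apply/permP => l; rewrite -{1}(pos_id l) /pos permKV.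
by case: t t' ek er {lt_t le_t' lt_level le_pos pos_id} => [? ?] [? ?] /= -> ->.
Qed.

Lemma rsegmentP p q r :
  rsegment p q r <-> exists2 s, 0 <= s <= 1 & r = (1 - s) *: p + s *: q.
Proof.
split=> [[s /= hs <-]|[s hs ->]]; exists s => //; by rewrite in_itv /= in hs *.
Qed.

Definition chord x y s : 'rV[R]_3 :=
  (1 - s) *: centre (zc x) + s *: centre (zc y).

(** At the centre of a face the tight inequality has gap 0 and the three others have gap [1/3]. *)
Lemma level_chord x y s (j : 'I_4) : y.1 = x.1 ->
  level x.1 (chord x y s) j.+1 - level x.1 (chord x y s) j =
    ((1 - s) * (x.2 != j)%:R + s * (y.2 != j)%:R) / 3.
Proof.
move=> yx; have j4 := ltn_ord j; rewrite /chord !level_affine ?(ltnW j4) //.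
rewrite !level_centre ?(ltnW j4) // -yx !level_centre ?(ltnW j4) //.
have step (i : 'I_4) : (j.+1 - (i < j.+1))%:R - (j - (i < j))%:R =
    (i != j)%:R :> R.
  rewrite -natrB; last by lia.
  by congr _%:R; rewrite -val_eqE /=; lia.
rewrite -!step; lra.
Qed.

Lemma chord_in_tetra x y s (j : 'I_4) : y.1 = x.1 -> 0 <= s <= 1 ->
  level x.1 (chord x y s) j <= level x.1 (chord x y s) j.+1.
Proof.
move=> yx s01; rewrite -subr_ge0 level_chord //.
by apply: divr_ge0 => //; apply: addr_ge0; apply: mulr_ge0 => //; lra.
Qed.

Lemma chord_interior x y s (j : 'I_4) : y.1 = x.1 -> x != y -> 0 < s < 1 ->
  level x.1 (chord x y s) j < level x.1 (chord x y s) j.+1.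
Proof.
move=> yx xy s01; rewrite -subr_gt0 level_chord //.
have [xj|] := eqVneq x.2 j; have [yj|] := eqVneq y.2 j => /=;
  rewrite ?mulr1 ?mulr0; try lra.
by case: x y xj yj yx xy => [? ?] [? ?] /= -> -> -> /eqP.
Qed.

End Geometry.

(** * 3-colour lines *)

Section Polyline.
Variable R : realType.
Implicit Types (p q : 'rV[R]_3) (c : nat -> 'rV[R]_3) (s : R).

Definition clamp s : R := Num.max 0 (Num.min s 1).

Lemma clamp_le0 s : s <= 0 -> clamp s = 0.
Proof. by move=> s0; rewrite /clamp max_l // ge_min s0. Qed.

Lemma clamp_id s : 0 <= s <= 1 -> clamp s = s.
Proof. by case/andP=> s0 s1; rewrite /clamp min_l // max_r. Qed.

Lemma clamp_ge1 s : 1 <= s -> clamp s = 1.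
Proof. by move=> s1; rewrite /clamp min_r // max_r. Qed.

(** A sum of clamped increments, so that continuity needs no gluing at the integers. *)
Fixpoint polyline c (L : nat) s : 'rV[R]_3 :=
  if L is L'.+1 then polyline c L' s + clamp (s - L'%:R) *: (c L'.+1 - c L')
  else c 0%N.

Lemma continuous_polyline c L : continuous (polyline c L).
Proof.
elim: L => [|L IH] s; first exact: cvg_cst.
apply: cvgD; first exact: IH.
apply: cvgZr_tmp.
apply: (@continuous_max _ _ (cst 0) (fun s => Num.min (s - L%:R) 1));
  first exact: cvg_cst.
apply: (@continuous_min _ _ (fun s => s - L%:R) (cst 1)); last exact: cvg_cst.
by apply: cvgB; [exact: cvg_id|exact: cvg_cst].
Qed.

Lemma polyline_end c L s : L%:R <= s -> polyline c L s = c L.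
Proof.
elim: L => // L IH; rewrite -natr1 => Ls /=.
rewrite IH ?clamp_ge1; [|lra|lra].
by rewrite scale1r addrC subrK.
Qed.

Lemma polylineE c L j s : (j < L)%N -> j%:R <= s <= j.+1%:R ->
  polyline c L s = (1 - (s - j%:R)) *: c j + (s - j%:R) *: c j.+1.
Proof.
elim: L => // L IH; rewrite ltnS leq_eqVlt => /orP[/eqP ->|jL] sj /=.
  move: sj; rewrite -natr1 => sj.
  rewrite polyline_end ?(andP sj).1// clamp_id; last lra.
  by apply/rowP => i; rewrite !mxE; ring.
have : j.+1%:R <= L%:R :> R by rewrite ler_nat.
move=> jL'; rewrite IH // clamp_le0; last lra.
by rewrite scale0r addr0.
Qed.

Lemma affine_onE (G : R -> 'rV[R]_3) a s : affine_on `[a, a + 1] G ->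
  a <= s <= a + 1 -> G s = (1 - (s - a)) *: G a + (s - a) *: G (a + 1).
Proof.
move=> [p [q Gpq]] sa; have h r : a <= r <= a + 1 -> G r = p + r *: q.
  by move=> ra; apply: Gpq; rewrite /= in_itv.
rewrite !h //; [|lra|lra].
by apply/rowP => i; rewrite !mxE; lra.
Qed.

Lemma affine_segment_ends (G : R -> 'rV[R]_3) a p q :
  affine_on `[a, a + 1] G -> set_bij `[a, a + 1] (rsegment p q) G ->
  G a = p /\ G (a + 1) = q \/ G a = q /\ G (a + 1) = p.
Proof.
move=> [p0 [q0 Gpq]] [Gfun Ginj Gsurj].
have inA r : a <= r <= a + 1 -> `[a, a + 1]%classic r by rewrite /= in_itv.
have seg s : 0 <= s <= 1 -> rsegment p q ((1 - s) *: p + s *: q).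
  by move=> s01; apply/rsegmentP; exists s.
have [s1 /= + Gs1] : (G @` `[a, a + 1]) p.
  by apply: Gsurj; have := seg 0; rewrite subr0 scale1r scale0r addr0; apply;
    lra.
have [s2 /= + Gs2] : (G @` `[a, a + 1]) q.
  by apply: Gsurj; have := seg 1; rewrite subrr scale1r scale0r add0r; apply;
    lra.
rewrite !in_itv /= => hs2 hs1.
(* By injectivity every parameter is a convex combination of [s1] and [s2], so these are the two
   ends of the interval. *)
have mid r : a <= r <= a + 1 -> exists2 s, 0 <= s <= 1 & r = (1 - s) * s1 + s *
  s2.
  move=> ra; have /rsegmentP[s s01 Gr] := Gfun _ (inA _ ra).
  exists s => //; apply: Ginj; rewrite ?inE /= ?in_itv /=; [exact: ra | nra |].
  rewrite Gr -Gs1 -Gs2 !Gpq; try (apply: inA; first [exact: ra|nra]).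
  by apply/rowP => i; rewrite !mxE; ring.
have [s s01 es] := mid a ltac:(lra).
have [r r01 er] := mid (a + 1) ltac:(lra).
have lo : s1 = a \/ s2 = a.
  by have [s0|s0] := eqVneq s 0; [left; rewrite es s0; lra|right; nra].
have hi : s1 = a + 1 \/ s2 = a + 1.
  by have [r0|r0] := eqVneq r 0; [left; rewrite er r0; lra|right; nra].
case: lo => lo; case: hi => hi.
- by exfalso; clear -lo hi; lra.
- by left; rewrite -Gs1 -Gs2 lo hi.
- by right; rewrite -Gs1 -Gs2 lo hi.
- by exfalso; clear -lo hi; lra.
Qed.

End Polyline.

(** * Correspondence between walks and 3-colour lines *)

Section Line.
Variables (R : realType) (N : nat).
Hypothesis hN : (0 < N)%N.
Variable u : dcube N -> colour.
Implicit Types (G : R -> 'rV[R]_3) (L : nat) (t : nat -> tetra N).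
Implicit Types (c : nat -> {ffun 'I_3 -> nat}).

Let cf : 'rV[R]_3 := centre R zc_start.
Let cf' : 'rV[R]_3 := centre R (zc_end N).

Definition walk_line L c : R -> 'rV[R]_3 :=
  polyline (fun j => centre R (c j)) L.

Lemma unit_interval L (s : R) : (0 < L)%N -> 0 <= s <= L%:R ->
  exists2 j, (j < L)%N & j%:R <= s <= j.+1%:R.
Proof.
case: L => // L _; elim: L => [|L IH] hs; first by exists 0%N.
have [sL|sL] := leP s L.+1%:R; last by exists L.+1 => //;
  rewrite (ltW sL) (andP hs).2.
by have [|j jL hj] := IH; [rewrite sL (andP hs).1|exists j => //; apply: ltnW].
Qed.

Lemma walk_line_chord L t c j : tricolour_walk u L t c -> (j < L)%N ->
  exists x y, [/\ tric u x, tric u y, x != y, x.1 = t j /\ y.1 = t j &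
    forall s, j%:R <= s <= j.+1%:R -> walk_line L c s = chord x y (s - j%:R)].
Proof.
move=> [_ w _ _ _] jL; have [x [y [ux uy xy xyt [xc yc]]]] := w j jL.
exists x, y; split=> // s sj; by rewrite /walk_line (polylineE _ jL sj) /chord
  xc yc.
Qed.

Lemma face_neq (x y : dart N) : x != y -> y.1 = x.1 -> y.2 != x.2.
Proof. by case: x y => [? ?] [? ?] /= + yx;
  rewrite yx xpair_eqE eqxx eq_sym. Qed.

Lemma chord_inj (x y : dart N) : x != y -> y.1 = x.1 ->
  injective (@chord R N x y).
Proof.
move=> xy yx s r e; have := level_chord s x.2 yx; rewrite e level_chord // eqxx.
by rewrite (face_neq xy yx) /=; lra.
Qed.

Lemma walk_line_joining L t c : tricolour_walk u L t c ->
  colour_line_joining u cf cf' L (walk_line L c).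
Proof.
move=> wk; have [L0 w t_neq c0 cL] := wk; split; last 2 first.
- by rewrite /walk_line (polylineE _ L0) ?lexx ?ler01 // subrr subr0 scale1r
  scale0r addr0 c0.
- by rewrite /walk_line polyline_end // cL.
split=> //.
- by apply: continuous_subspaceT; exact: continuous_polyline.
- move=> s /(unit_interval L0)[j jL sj].
  have [x [y [_ _ _ [xt yt] e]]] := walk_line_chord wk jL; rewrite e //.
  apply: (@tetra_in_cube _ _ x.1) => i; apply: chord_in_tetra;
    first by rewrite yt xt.
  by move: sj; rewrite -natr1; lra.
exists t; split=> // j jL; have [x [y [ux uy xy [xt yt] e]]] :=
  walk_line_chord wk jL.
split.
  exists (chord x y (- j%:R)), (centre R (zc y) - centre R (zc x)) => s.
  rewrite /= in_itv /= => sj; rewrite e //.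
  by apply/rowP => i; rewrite !mxE; ring.
have yx : y.1 = x.1 by rewrite yt xt.
exists (rsegment (centre R (zc x)) (centre R (zc y))).
  exists x.2, y.2; split; [by rewrite eq_sym face_neq | | |].
  - by apply/tricolourE; rewrite -xt -surjective_pairing.
  - by apply/tricolourE; rewrite -yt -surjective_pairing.
  - by rewrite !face_centreE -{1}xt -yt -!surjective_pairing.
split.
- move=> s; rewrite /= in_itv /= => sj; rewrite e //; apply/rsegmentP.
  by exists (s - j%:R) => //; move: sj; rewrite -natr1; lra.
- move=> s r; rewrite !inE /= !in_itv /= => sj rj; rewrite !e //.
  by move/(chord_inj xy yx)/addIr.
- move=> p /rsegmentP[s s01 ->]; exists (s + j%:R).
    by rewrite /= in_itv /= -natr1; lra.
  by rewrite e ?addrK // -natr1; lra.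
Qed.

Lemma walk_line_inj L t c : tricolour_walk u L t c ->
  (forall i k, (i < L)%N -> (k < L)%N -> t i = t k -> i = k) ->
  (forall i k, (i <= L)%N -> (k <= L)%N -> c i = c k -> i = k) ->
  non_self_intersecting L (walk_line L c).
Proof.
move=> wk t_inj c_inj; have [L0 _ _ _ _] := wk.
have ends j : (j <= L)%N -> walk_line L c j%:R = centre R (c j).
  rewrite leq_eqVlt => /orP[/eqP ->|jL]; first exact: polyline_end.
  by rewrite /walk_line (polylineE _ jL) ?lexx ?ler_nat ?leqnSn // subrr subr0
    scale1r scale0r addr0.
(* A point inside segment [j] is interior to [t j], so any segment through it lies in the same
   tetrahedron and, by [t_inj], is segment [j] itself. *)
have inner s j : (j < L)%N -> j%:R < s < j.+1%:R -> forall r, 0 <= r <= L%:R ->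
    walk_line L c s = walk_line L c r -> s = r.
  move=> jL sj r /(unit_interval L0)[k kL rk].
  have [x [y [_ _ xy [xt yt] e]]] := walk_line_chord wk jL.
  have [x' [y' [_ _ xy' [xt' yt'] e']]] := walk_line_chord wk kL.
  have yx : y.1 = x.1 by rewrite yt xt.
  have yx' : y'.1 = x'.1 by rewrite yt' xt'.
  have sj' : j%:R <= s <= j.+1%:R by move: sj; lra.
  move=> sr; have jk : j = k.
    apply: t_inj => //; rewrite -xt -xt';
      apply: (@interior_unique R _ _ _ (walk_line L c s)) => i.
      by rewrite e //; apply: chord_interior => //; move: sj; rewrite -natr1;
        lra.
    by rewrite sr e' //; apply: chord_in_tetra => //; move: rk; rewrite -natr1;
      lra.
  by move: sr; rewrite -jk in rk; rewrite !e // => /(chord_inj xy yx)/addIr.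
have split_itv (s : R) : 0 <= s <= L%:R -> (exists2 j, (j <= L)%N & s = j%:R) \/
    exists2 j, (j < L)%N & j%:R < s < j.+1%:R.
  move=> /(unit_interval L0)[j jL /andP[]].
  rewrite le_eqVlt => /predU1P[<- _|js]; first by left; exists j => //;
    apply: ltnW.
  rewrite le_eqVlt => /predU1P[-> |sj]; first by left; exists j.+1.
  by right; exists j => //; rewrite js.
move=> s r; rewrite !inE /= !in_itv /= => hs hr.
have [[j jL sj]|[j jL sj]] := split_itv s hs; last exact: inner jL sj _ hr.
have [[k kL rk]|[k kL rk]] := split_itv r hr; last first.
  by move=> sr; apply/esym; exact: inner kL rk _ hs (esym sr).
by rewrite sj rk !ends // => /centre_inj/c_inj ->.
Qed.

(** Each affine piece maps its ends to the two tricolour face centres of its tetrahedron and is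
    determined by them. *)
Lemma joining_walk L G : colour_line_joining u cf cf' L G ->
  exists t c, tricolour_walk u L t c /\
    forall s, 0 <= s <= L%:R -> G s = walk_line L c s.
Proof.
move=> [[L0 _ _ [t [h t_neq]]] G0 GL].
have step j : (j < L)%N -> exists x y, [/\ tric u x, tric u y, x != y,
    x.1 = t j /\ y.1 = t j & G j%:R = centre R (zc x) /\ G j.+1%:R = centre R
      (zc y)].
  move=> jL; have [aff [S [a [b [ab /tricolourE ua /tricolourE ub ->]]] bij]]
    := h j jL.
  have ne : (t j, a) != (t j, b) :> dart N by rewrite xpair_eqE eqxx.
  rewrite !face_centreE -natr1 in aff bij *.
  have [[Ga Gb]|[Gb Ga]] := affine_segment_ends aff bij.
    by exists (t j, a), (t j, b).
  by exists (t j, b), (t j, a); split=> //; rewrite eq_sym.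
have [c cP] : exists c : nat -> {ffun 'I_3 -> nat}, forall j, (j <= L)%N ->
  G j%:R = centre R (c j).
  suff /choice[c cP] : forall j, exists z, (j <= L)%N ->
    G j%:R = centre R z by exists c.
  move=> j; have [jL|jL] := ltnP j L.
    by have [x [_ [_ _ _ _ [e _]]]] := step j jL; exists (zc x).
  (* No segment starts at time [L]; the prescribed end point gives the centre there. *)
  exists (zc_end N) => Lj; rewrite (_ : j = L) ?GL //; apply/eqP.
  by rewrite eqn_leq Lj.
exists t, c; split.
  split=> //.
  - move=> j jL; have [x [y [ux uy xy xyt [xc yc]]]] := step j jL; exists x, y;
    split=> //.
    by split; apply: (@centre_inj R); rewrite -?xc -?yc cP // ltnW.
  - by apply: (@centre_inj R); rewrite -cP.
  - by apply: (@centre_inj R); rewrite -cP.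
move=> s /(unit_interval L0)[j jL sj]; rewrite /walk_line (polylineE _ jL sj).
have [aff _] := h j jL; rewrite -!cP //; last exact: ltnW.
by rewrite -natr1 in aff sj *; exact: affine_onE.
Qed.

Lemma colour_line_unique : dobrushin_colouring u -> exists L G,
  [/\ colour_line_joining u cf cf' L G, non_self_intersecting L G &
     forall L' G', colour_line_joining u cf cf' L' G' ->
       L' = L /\ forall s, 0 <= s <= L%:R -> G' s = G s].
Proof.
move=> hu; have [m [t [c [wk t_inj c_inj uniq]]]] :=
  tricolour_walk_unique hN hu.
exists m, (walk_line m c); split.
- exact: walk_line_joining wk.
- exact: walk_line_inj wk t_inj c_inj.
move=> L' G' /joining_walk[t' [c' [/uniq[-> cc] GE]]]; split=> // s sm.
have [m0 _ _ _ _] := wk; have [j jm sj] := unit_interval m0 sm.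
by rewrite GE // /walk_line !(polylineE _ jm sj) !cc // ltnW.
Qed.

End Line.

(** * Random colours *)

Lemma centre_start (R : realType) : centre R zc_start =
  barycentre3 (rpoint R 0 0 0) (rpoint R 1 0 0) (rpoint R 1 0 1).
Proof.
by apply/rowP; apply: forall_ord3; rewrite !mxE ffunE /=; lra.
Qed.

Lemma centre_end (R : realType) (N : nat) : (0 < N)%N -> centre R (zc_end N) =
  barycentre3 (rpoint R N N N) (rpoint R N N.-1 N) (rpoint R N N.-1 N.-1).
Proof.
case: N => // N _; apply/rowP; apply: forall_ord3; rewrite !mxE ffunE /=.
- by rewrite subn0 natrM; lra.
- by rewrite (_ : 3 * N.+1 - 2 = 3 * N + 1)%N ?natrD ?natrM -?natr1; [lra|lia].
- by rewrite (_ : 3 * N.+1 - 1 = 3 * N + 2)%N ?natrD ?natrM -?natr1; [lra|lia].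
Qed.

Section Random.
Context {R : realType} {d : measure_display} {T : measurableType d}.
Variable P : probability T R.

Lemma ae_dobrushin N (U : dcube N -> T -> colour) : dobrushin_model P U ->
  \forall w \ae P, dobrushin_colouring (U^~ w).
Proof.
move=> hU.
have ae_set (S : {set dcube N}) c : (forall x, x \in S ->
  \forall w \ae P, U x w = c) ->
    \forall w \ae P, forall x, x \in S -> U x w = c.
  move=> h; apply: filter_forall => x; have [xS|xS] := boolP (x \in S).
    by apply: filterS (h x xS).
  exact: filterE.
have h0 := ae_set _ _ (dobrushin_colour0 hU).
have h1 := ae_set _ _ (dobrushin_colour1 hU).
have h2 := ae_set _ _ (dobrushin_colour2 hU).
by apply: filterS3 h0 h1 h2 => w; split.
Qed.

(** The preimage is a finite union, over configurations [f], of finite intersections of the events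
    [U i = f i]. *)
Lemma measurable_configuration (I : finType) (U : I -> T -> colour) X
    (F : (I -> colour) -> X) (B : set X) : (forall i, colour_variable (U i)) ->
  measurable ((fun w => F (U^~ w)) @^-1` B).
Proof.
move=> mU; have -> : (fun w => F (U^~ w)) @^-1` B =
  \bigcup_(f in [set f : {ffun I -> colour} | B (F f)])
    \bigcap_(i in [set: I]) (U i @^-1` [set f i]).
  apply/seteqP; split=> [w Bw|w [f Bf hf]].
    have fE : [ffun i => U i w] = U^~ w :> (I -> colour).
      by apply/funext => i; rewrite ffunE.
    by exists [ffun i => U i w] => [|i _]; rewrite /= ?fE ?ffunE.
  by rewrite /= (_ : U^~ w = f) //; apply/funext => i; exact: hf.
apply: fin_bigcup_measurable => [|f _]; first exact: finite_finset.
by apply: fin_bigcap_measurable => [|i _]; [exact: finite_finset|exact: mU].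
Qed.

End Random.

Theorem proposition1p1 (R : realType) (d : measure_display)
    (T : measurableType d) (P : probability T R) (N : nat) (hN : (1 <= N)%N)
    (U : dcube N -> T -> colour) (hU : dobrushin_model P U) :
  let cf : 'rV[R]_3 :=
    barycentre3 (rpoint R 0 0 0) (rpoint R 1 0 0) (rpoint R 1 0 1) in
  let cf' : 'rV[R]_3 :=
    barycentre3 (rpoint R N N N) (rpoint R N N.-1 N)
                (rpoint R N N.-1 N.-1) in
  (\forall w \ae P, exists (L : nat) (G : R -> 'rV[R]_3),
     [/\ colour_line_joining (U^~ w) cf cf' L G,
         non_self_intersecting L G &
         forall (L' : nat) (G' : R -> 'rV[R]_3),
           colour_line_joining (U^~ w) cf cf' L' G' ->
           L' = L /\ forall s : R, 0 <= s <= L%:R -> G' s = G s]) /\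
  (exists (L : T -> nat) (G : T -> R -> 'rV[R]_3),
     random_curve L G /\
     \forall w \ae P,
       colour_line_joining (U^~ w) cf cf' (L w) (G w) /\
       non_self_intersecting (L w) (G w)).
Proof.
rewrite /= -centre_start -(centre_end _ hN).
have hae := ae_dobrushin hU.
split; first by apply: filterS hae => w; exact: colour_line_unique.
(* Stated as an implication, [good] can be met for every [u], so that choice yields a function [F]
   of the whole configuration; off the almost sure event its value is arbitrary. *)
pose good (u : dcube N -> colour) (LG : nat * (R -> 'rV[R]_3)) :=
  dobrushin_colouring u ->
  colour_line_joining u (centre R zc_start) (centre R (zc_end N)) LG.1 LG.2 /\
  non_self_intersecting LG.1 LG.2.
have /choice[F hF] : forall u, exists LG, good u LG.
  move=> u; have [hu|nu] := pselect (dobrushin_colouring u);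
    last by exists (0%N, cst 0).
  by have [L [G [join inj _]]] := colour_line_unique R hN hu; exists (L, G).
exists (fun w => (F (U^~ w)).1), (fun w => (F (U^~ w)).2); split; last first.
  by apply: filterS hae => w; exact: hF.
have mU x : colour_variable (U x) by exact: dobrushin_measurable hU x.
split=> [|s i] _ B _; rewrite setTI.
- exact: (measurable_configuration (fun u => (F u).1) B mU).
- exact: (measurable_configuration (fun u => (F u).2 s 0 i) B mU).
Qed.
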